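(* Let $G$ be a finite group of one-to-one transformations of $\mathcal{X}$ onto itself such that for each $g\in G$ there is a nonsingular matrix $\mathbf{Q}_g$ with $\mathbf{f}(g(\mathbf{x}))=\mathbf{Q}_g\mathbf{f}(\mathbf{x})$ for all $\mathbf{x}\in\mathcal{X}$, and let $\tilde g$, $g\in G$, be the associated parameter transformations (described in the context). Let $\mathcal{B}'\subseteq\mathcal{B}$. (i) If $\tilde g(\mathcal{B}')=\mathcal{B}'$ for all $g\in G$, then there exists a maximin $D$-efficient design $\xi^*$ on $\mathcal{B}'$ which is invariant with respect to $G$. (ii) If additionally the standardized measure $\nu$ on $\mathcal{X}$ is invariant with respect to $G$, i.e. $\nu^g=\nu$ for all $g\in G$, then there exists a maximin $IMSE$-efficient design $\xi^*$ on $\mathcal{B}'$ with respect to $\nu$ which is invariant with respect to $G$.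
   Context: $\mathbf{f}:\mathcal{X}\to\mathbb{R}^p$ is a vector of regression functions, linearly independent on the experimental region $\mathcal{X}$; $\mathcal{B}\subseteq\mathbb{R}^p$ is the parameter region; $\lambda$ (the intensity function) is a positive real function defined on a set of reals containing all values $\mathbf{f}(\mathbf{x})^{\mathsf T}\boldsymbol\beta$, $\mathbf{x}\in\mathcal{X}$, $\boldsymbol\beta\in\mathcal{B}$. Each parameter transformation $\tilde g$ maps $\mathcal{B}$ onto $\mathcal{B}$ and is of one of two kinds: either (linear case) $\tilde g(\boldsymbol\beta)=\mathbf{Q}_g^{-\mathsf T}\boldsymbol\beta$ for all $g\in G$; or (extended case, only for the gamma model with inverse link, where $\lambda(z)=\kappa/z^2$ for $z>0$ with fixed $\kappa>0$ and $\mathbf{f}(\mathbf{x})^{\mathsf T}\boldsymbol\beta>0$ on $\mathcal{X}$ for all $\boldsymbol\beta\in\mathcal{B}$) $\tilde g(\boldsymbol\beta)=\tilde c_g(\boldsymbol\beta)\mathbf{Q}_g^{-\mathsf T}\boldsymbol\beta$ with functions $\tilde c_g:\mathcal{B}\to(0,\infty)$ such that the $\tilde g$ share the group structure of $G$, i.e. the transformation associated with $g\circ h$ is $\tilde g\circ\tilde h$. Here $\mathbf{Q}^{-\mathsf T}$ denotes the inverse of the transpose of $\mathbf{Q}$. A design $\xi$ on $\mathcal{X}$ is given by finitely many distinct support points $\mathbf{x}_i\in\mathcal{X}$ and weights $w_i>0$, $\sum_iw_i=1$; $\xi^g$ has support points $g(\mathbf{x}_i)$ and weights $w_i$; a standardized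 measure is one with $\nu(\mathcal{X})=1$, and $\nu^g$ is the image of $\nu$ under $g$; $\xi$ is invariant with respect to $G$ if $\xi^g=\xi$ for all $g\in G$. Information matrix: $\mathbf{M}(\xi;\boldsymbol\beta)=\sum_iw_i\,\lambda(\mathbf{f}(\mathbf{x}_i)^{\mathsf T}\boldsymbol\beta)\,\mathbf{f}(\mathbf{x}_i)\mathbf{f}(\mathbf{x}_i)^{\mathsf T}$. Homogeneous local $D$-criterion: $\Phi_{\boldsymbol\beta}(\xi)=\det(\mathbf{M}(\xi;\boldsymbol\beta))^{-1/p}$ ($\infty$ for singular $\mathbf{M}(\xi;\boldsymbol\beta)$). Local $IMSE$-criterion with respect to $\nu$: $\Phi_{\boldsymbol\beta}(\xi)=\mathrm{trace}(\mathbf{V}(\boldsymbol\beta;\nu)\mathbf{M}(\xi;\boldsymbol\beta)^{-1})$ (for nonsingular $\mathbf{M}(\xi;\boldsymbol\beta)$) with $\mathbf{V}(\boldsymbol\beta;\nu)=\int\lambda(\mathbf{f}(\mathbf{x})^{\mathsf T}\boldsymbol\beta)^2\,\mathbf{f}(\mathbf{x})\mathbf{f}(\mathbf{x})^{\mathsf T}\,\nu(\mathrm{d}\mathbf{x})$. For either criterion, $\xi^*_{\boldsymbol\beta}$ denotes the locally optimal design at $\boldsymbol\beta$, i.e. the minimizer of $\Phi_{\boldsymbol\beta}$ over the designs on $\mathcal{X}$. A design is maximin $D$-efficient (resp. maximin $IMSE$-efficient with respect to $\nu$) on $\mathcal{B}'$ if it minimizes $\sup_{\boldsymbol\beta\in\mathcal{B}'}\Phi_{\boldsymbol\beta}(\xi)/\Phi_{\boldsymbol\beta}(\xi^*_{\boldsymbol\beta})$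 over the designs $\xi$ on $\mathcal{X}$, for the corresponding criterion.
   Formalization: Existence of some maximin D-efficient (resp. IMSE-efficient) design on B' is assumed, because without it the claim fails even for trivial G; what is proved is that an invariant maximin efficient design then exists. *)

(* Defs.v *)
From HB Require Import structures.
From mathcomp Require Import all_boot all_order all_algebra finmap.
From mathcomp Require Import all_classical all_reals all_analysis.

Set Implicit Arguments.
Unset Strict Implicit.
Unset Printing Implicit Defensive.

Import Order.TTheory GRing.Theory Num.Theory.
Import numFieldNormedType.Exports.

Local Open Scope classical_set_scope.
Local Open Scope ring_scope.

Section Designs.
Context {R : realType} {T : choiceType}.

(* A weight function [xi] encodes a design: its support points are the elements
   of [finsupp xi], and the weight of the support point [x] is [xi x]. Equality
   of designs is thus independent of any numbering of the support points. *)
Definition is_design (xi : {fsfun T -> R with 0}) : Prop :=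
  {in finsupp xi, forall x, 0 < xi x} /\ \sum_(x <- finsupp xi) xi x = 1.

(* For one-to-one [g] the inner sum has the single term [xi x] with [g x = y]. *)
Definition design_image (g : T -> T) (xi : {fsfun T -> R with 0}) :
    {fsfun T -> R with 0} :=
  [fsfun y in [fset g x | x in finsupp xi]%fset =>
     \sum_(x <- finsupp xi | g x == y) xi x].

Definition invariant_design (G : set (T -> T)) (xi : {fsfun T -> R with 0}) :
    Prop :=
  forall g, G g -> design_image g xi = xi.

End Designs.

Definition finite_transformation_group {T : Type} (G : set (T -> T)) : Prop :=
  [/\ finite_set G,
      G id,
      (forall g h, G g -> G h -> G (g \o h))
    & (forall g, G g -> exists2 h, G h & cancel g h /\ cancel h g)].

Section Model.
Context {R : realType} {T : choiceType} {p : nat}.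
Variables (f : T -> 'cV[R]_p) (lam : R -> R).

Definition linearly_independent : Prop :=
  forall a : 'cV[R]_p, (forall x, (a^T *m f x) 0 0 = 0) -> a = 0.

Definition predictor (x : T) (beta : 'cV[R]_p) : R := ((f x)^T *m beta) 0 0.

Definition information_matrix (xi : {fsfun T -> R with 0}) (beta : 'cV[R]_p) :
    'M[R]_p :=
  \sum_(x <- finsupp xi)
    (xi x * lam (predictor x beta)) *: (f x *m (f x)^T).

Definition D_criterion (beta : 'cV[R]_p) (xi : {fsfun T -> R with 0}) : \bar R :=
  let M := information_matrix xi beta in
  if M \in unitmx then ((\det M) `^ (- p%:R^-1))%:E else +oo%E.

Definition linear_transformations (G : set (T -> T))
    (Q : (T -> T) -> 'M[R]_p) (B : set 'cV[R]_p)
    (tg : (T -> T) -> 'cV[R]_p -> 'cV[R]_p) : Prop :=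
  forall g beta, G g -> B beta -> tg g beta = invmx (Q g)^T *m beta.

Definition gamma_model (B : set 'cV[R]_p) : Prop :=
  (exists2 kappa, 0 < kappa & forall z, 0 < z -> lam z = kappa / z ^+ 2) /\
  (forall x beta, B beta -> 0 < predictor x beta).

Definition extended_transformations (G : set (T -> T))
    (Q : (T -> T) -> 'M[R]_p) (B : set 'cV[R]_p)
    (tg : (T -> T) -> 'cV[R]_p -> 'cV[R]_p) : Prop :=
  (exists c : (T -> T) -> 'cV[R]_p -> R,
     forall g beta, G g -> B beta ->
       0 < c g beta /\ tg g beta = c g beta *: (invmx (Q g)^T *m beta)) /\
  (forall g h beta, G g -> G h -> B beta ->
     tg (g \o h) beta = tg g (tg h beta)).

Definition parameter_transformations (G : set (T -> T))
    (Q : (T -> T) -> 'M[R]_p) (B : set 'cV[R]_p)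
    (tg : (T -> T) -> 'cV[R]_p -> 'cV[R]_p) : Prop :=
  (forall g, G g -> tg g @` B = B) /\
  (linear_transformations G Q B tg \/
   gamma_model B /\ extended_transformations G Q B tg).

End Model.

Section IMSE.
Context {R : realType} {d : measure_display} {T : measurableType d} {p : nat}.
Variables (f : T -> 'cV[R]_p) (lam : R -> R).

Definition IMSE_integrand (beta : 'cV[R]_p) (i j : 'I_p) (x : T) : R :=
  lam (predictor f x beta) ^+ 2 * (f x *m (f x)^T) i j.

Definition IMSE_weight_exists (nu : probability T R) (beta : 'cV[R]_p) : Prop :=
  forall i j, nu.-integrable [set: T] (EFin \o IMSE_integrand beta i j).

Definition IMSE_weight (nu : probability T R) (beta : 'cV[R]_p) : 'M[R]_p :=
  \matrix_(i, j) Rintegral nu [set: T] (IMSE_integrand beta i j).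

Definition IMSE_criterion (nu : probability T R) (beta : 'cV[R]_p)
    (xi : {fsfun T -> R with 0}) : \bar R :=
  let M := information_matrix f lam xi beta in
  if M \in unitmx then (\tr (IMSE_weight nu beta *m invmx M))%:E else +oo%E.

Definition invariant_measure (G : set (T -> T)) (nu : probability T R) : Prop :=
  forall g, G g -> measurable_fun [set: T] g /\
    forall A, measurable A -> pushforward nu g A = nu A.

End IMSE.

Section Optimality.
Context {R : realType} {T : choiceType} {p : nat}.
Variable Phi : 'cV[R]_p -> {fsfun T -> R with 0} -> \bar R.

Definition locally_optimal (beta : 'cV[R]_p) (xi : {fsfun T -> R with 0}) :
    Prop :=
  is_design xi /\ forall xi', is_design xi' -> (Phi beta xi <= Phi beta xi')%E.

(* [xiopt beta] is a locally optimal design at [beta]. In [\bar R],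
   [0 / 0 = 0] and [+oo / 0 = +oo]; a zero denominator only arises for the
   IMSE-criterion in the degenerate case of a vanishing weight matrix. *)
Definition maximin_criterion (xiopt : 'cV[R]_p -> {fsfun T -> R with 0})
    (B' : set 'cV[R]_p) (xi : {fsfun T -> R with 0}) : \bar R :=
  ereal_sup [set (Phi beta xi / Phi beta (xiopt beta))%E | beta in B'].

Definition maximin_efficient (xiopt : 'cV[R]_p -> {fsfun T -> R with 0})
    (B' : set 'cV[R]_p) (xi : {fsfun T -> R with 0}) : Prop :=
  is_design xi /\
  forall xi', is_design xi' ->
    (maximin_criterion xiopt B' xi <= maximin_criterion xiopt B' xi')%E.

End Optimality.

(* Main.v *)
(* The average [xi_bar] of the images [xi^g] of a maximin efficient design [xi]
   is invariant. Equivariance gives [M(xi^g; tg beta) = c Q_g M(xi; beta) Q_g^T]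
   with [c > 0] depending on [g] and [beta] only, so that both criteria are
   multiplied by a positive factor independent of [xi]; the efficiency ratio of
   [xi^g] at [tg beta] is therefore that of [xi] at [beta], and [xi^g] has the
   same maximin criterion as [xi]. Finally, both criteria are quasi-convex: at
   each [beta], [xi_bar] is no worse than the worst of the [xi^g]. *)

Require Import Defs.
From HB Require Import structures.
From mathcomp Require Import all_boot all_order all_algebra finmap.
From mathcomp Require Import ring lra.
From mathcomp Require Import all_classical all_reals all_analysis.

Set Implicit Arguments.
Unset Strict Implicit.
Unset Printing Implicit Defensive.

Import Order.TTheory GRing.Theory Num.Theory.
Import numFieldNormedType.Exports.

Local Open Scope classical_set_scope.
Local Open Scope ring_scope.

(** * Positive definite matrices: Hadamard's inequality, and means inside [\det] and inside the
    trace of an inverse *)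

Section PositiveDefinite.
Context {R : realFieldType}.

Definition posdef n (A : 'M[R]_n) : Prop :=
  A^T = A /\ forall u : 'cV[R]_n, u != 0 -> 0 < (u^T *m A *m u) 0 0.

Lemma posdef_congr n (P A : 'M[R]_n) :
  P \in unitmx -> posdef A -> posdef (P *m A *m P^T).
Proof.
move=> Pu [At Apos]; split; first by rewrite !trmx_mul trmxK At mulmxA.
move=> u u0; have PT0 : P^T *m u != 0.
  apply: contra_neq u0 => PTu0.
  have PTu : P^T \in unitmx by rewrite unitmx_tr.
  by rewrite -(mulKmx PTu u) PTu0 mulmx0.
by have := Apos _ PT0; rewrite trmx_mul trmxK !mulmxA.
Qed.

Lemma posdef_unitmx n (A : 'M[R]_n) : posdef A -> A \in unitmx.
Proof.
move=> [At Apos]; rewrite -row_free_unit; apply/row_freeP.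
have : row_free A.
  rewrite -kermx_eq0; apply: contraT => /rowV0Pn[v /sub_kermxP vA0 v0].
  have vT0 : v^T != 0 by rewrite trmx_eq0.
  by have := Apos _ vT0; rewrite trmxK vA0 mul0mx mxE ltxx.
by move/row_freeP.
Qed.

Lemma posdef_diag_gt0 n (A : 'M[R]_n) i : posdef A -> 0 < A i i.
Proof.
move=> [_ Apos]; have /Apos : (delta_mx i 0 : 'cV[R]_n) != 0.
  by apply/eqP => /matrixP/(_ i 0)/eqP; rewrite !mxE !eqxx oner_eq0.
by rewrite trmx_delta -rowE -colE !mxE.
Qed.

(** One step of symmetric Gaussian elimination: [P] is unit lower triangular and clears the first
    column, and [S] is the Schur complement of the corner entry [a]. The diagonal can only shrink,
    since [S] arises by subtracting [a^-1 *: (l *m l^T)]. Both inductions on the size of a matrix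
    below rest on this step. *)
Lemma posdef_schur n (A : 'M[R]_(1 + n)) : posdef A ->
  exists (a : R) (P : 'M[R]_(1 + n)) (S : 'M[R]_n),
    [/\ A (lshift n 0) (lshift n 0) = a /\ 0 < a, \det P = 1,
        P *m A *m P^T = block_mx a%:M 0 0 S, posdef S &
        forall i, S i i <= A (rshift 1 i) (rshift 1 i)].
Proof.
move=> Apd; have [At Apos] := Apd.
pose a := A (lshift n 0) (lshift n 0).
pose l := dlsubmx A.
pose S := drsubmx A - a^-1 *: (l *m l^T).
pose P : 'M[R]_(1 + n) := block_mx 1%:M 0 (- a^-1 *: l) 1%:M.
have ul : ulsubmx A = a%:M by rewrite [LHS]mx11_scalar !mxE.
have ur : ursubmx A = l^T by rewrite trmx_dlsub At.
have a0 : 0 < a by exact: posdef_diag_gt0.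
have detP : \det P = 1 by rewrite det_lblock !det1 mulr1.
have PAP : P *m A *m P^T = block_mx a%:M 0 0 S.
  rewrite -[A in P *m A]submxK ul ur -/l mulmx_block tr_block_mx mulmx_block.
  rewrite !mul1mx !mul0mx !addr0 !trmx1 !trmx0 !mulmx1 !mulmx0 !addr0.
  rewrite linearZ /= -!scalemxAl -!scalemxAr !mul_scalar_mx !mul_mx_scalar.
  rewrite !scalerA !mulNr mulVf ?gt_eqF// !scaleN1r !addNr mul0mx scaler0 add0r.
  by rewrite scaleNr /S [- _ + _]addrC.
exists a, P, S; split => //.
- have [St Spos] : posdef (block_mx a%:M 0 0 S : 'M[R]_(1 + n)).
    by rewrite -PAP; apply: posdef_congr => //; rewrite unitmxE detP unitr1.
  split.
    by move: St; rewrite tr_block_mx => /eq_block_mx[].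
  move=> u u0; have /Spos : col_mx (0 : 'cV[R]_1) u != 0.
    by rewrite col_mx_eq0 negb_and u0 orbT.
  by rewrite tr_col_mx mul_row_block mul_row_col !trmx0 !mul0mx !mulmx0 !add0r.
- move=> i; rewrite !mxE gerBl mulr_ge0 ?invr_ge0 ?(ltW a0)// sumr_ge0// => j _.
  by rewrite [l^T _ _]mxE -expr2 sqr_ge0.
Qed.

(** Induction through the Schur complement: [\det A = a * \det S], and the diagonal of [S] is
    dominated by that of [A]. *)
Lemma posdef_hadamard n (A : 'M[R]_n) :
  posdef A -> 0 < \det A <= \prod_i A i i.
Proof.
elim: n A => [|n IHn] A; first by rewrite det_mx00 big_ord0 ltr01 lexx.
rewrite -[n.+1]/(1 + n)%N in A * => Apd.
have [a [P [S [[Aa a0] detP PAP Spd SA]]]] := posdef_schur Apd.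
have := congr1 determinant PAP.
rewrite !det_mulmx det_tr detP mul1r mulr1 det_ublock det_scalar expr1 => ->.
have /andP[S0 SS] := IHn _ Spd.
rewrite (@big_split_ord _ _ _ 1 n) /= big_ord1 Aa mulr_gt0//= ler_pM2l//.
apply: (le_trans SS); apply: ler_prod => i _.
by rewrite SA (ltW (posdef_diag_gt0 _ Spd)).
Qed.

Lemma posdef_det_gt0 n (A : 'M[R]_n) : posdef A -> 0 < \det A.
Proof. by move=> /posdef_hadamard/andP[]. Qed.

(** Elimination iterated. The congruence has determinant 1, so it preserves determinants while
    making the matrix diagonal. *)
Lemma posdef_diag n (A : 'M[R]_n) : posdef A ->
  exists (P : 'M[R]_n) (e : 'rV_n),
    [/\ \det P = 1, P *m A *m P^T = diag_mx e & forall i, 0 < e 0 i].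
Proof.
elim: n A => [|n IHn] A.
  by exists 1%:M, 0; split; [rewrite det1 | apply/matrixP; case | case].
rewrite -[n.+1]/(1 + n)%N in A * => Apd.
have [a [P [S [[Aa a0] detP PAP /IHn[P1 [e [detP1 PSP e0]]] _]]]] :=
  posdef_schur Apd.
exists (block_mx 1%:M 0 0 P1 *m P), (row_mx a%:M e); split.
- by rewrite det_mulmx det_lblock det1 detP detP1 !mulr1.
- rewrite trmx_mul -!mulmxA (mulmxA P) (mulmxA (P *m A)) PAP.
  rewrite tr_block_mx ?mulmx_block ?trmx0 ?trmx1 ?mul1mx ?mul0mx ?mulmx1.
  rewrite ?mul0mx ?mulmx0 ?addr0 ?add0r ?mul0mx ?mulmx0 mulmxA PSP diag_mx_row.
  by congr block_mx; apply/matrixP => i j; rewrite !ord1 !mxE !eqxx.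
- move=> i; case: (split_ordP i) => j ->.
    by rewrite row_mxEl ord1 !mxE eqxx.
  by rewrite row_mxEr.
Qed.

(* Diagonalizing [N] by a congruence of determinant 1 reduces the claim to
   Hadamard's inequality for the transform of [M] followed by the inequality
   of arithmetic and geometric means. *)
Lemma posdef_det_le n (N M : 'M[R]_n) : (0 < n)%N ->
  posdef N -> posdef M -> \tr (invmx N *m M) <= n%:R -> \det M <= \det N.
Proof.
move=> n0 Npd Mpd trNM.
have [P [e [detP PNP e0]]] := posdef_diag Npd.
have Pu : P \in unitmx by rewrite unitmxE detP unitr1.
have De : diag_mx e \in unitmx.
  by rewrite -PNP !unitmx_mul Pu unitmx_tr Pu posdef_unitmx.
pose M' := P *m M *m P^T.
have M'pd : posdef M' by exact: posdef_congr.
have detM' : \det M' = \det M by rewrite !det_mulmx det_tr detP mul1r mulr1.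
have detN : \det N = \prod_i e 0 i.
  by rewrite -det_diag -PNP !det_mulmx det_tr detP mul1r mulr1.
have invD : invmx (diag_mx e) = diag_mx (\row_i (e 0 i)^-1).
  apply: (can_inj (mulKmx De)); rewrite mulmxV// mulmx_diag.
  by apply/matrixP => i j; rewrite !mxE divff// ?gt_eqF.
(* As [invmx N] is [P^T *m invmx (diag_mx e) *m P], cyclicity of the trace moves [P] and [P^T]
   around [M]. *)
have trE : \tr (invmx N *m M) = \sum_i M' i i / e 0 i.
  have -> : invmx N = P^T *m invmx (diag_mx e) *m P.
    apply: (can_inj (mulKmx (posdef_unitmx Npd))).
    rewrite mulmxV ?posdef_unitmx//; apply: (can_inj (mulKmx Pu)).
    by rewrite mulmx1 !mulmxA PNP mulmxV// mul1mx.
  rewrite -!mulmxA mxtrace_mulC -!mulmxA (mulmxA P) -/M' invD mul_diag_mx.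
  by apply: eq_bigr => i _; rewrite !mxE mulrC.
have := posdef_hadamard M'pd; rewrite detM' => /andP[_ /le_trans]; apply.
rewrite detN -[leRHS]mul1r -ler_pdivrMr ?prodr_gt0//.
rewrite -prodf_div.
have Fge0 i : 0 <= M' i i / e 0 i.
  by rewrite divr_ge0 ?(ltW (e0 i)) ?(ltW (posdef_diag_gt0 _ M'pd)).
(* The arithmetic mean of the ratios is the given trace divided by [n], hence at most 1, and so is
   its [n]-th power. *)
apply: le_trans (leif_AGM (A := 'I_n) (fun i _ => Fge0 i)) _.
rewrite card_ord exprn_ile1 ?divr_ge0 ?sumr_ge0//.
by rewrite ler_pdivrMr ?ltr0n// mul1r -trE.
Qed.

(** Selects the index in the two mean inequalities below: a bound on an average of traces yields one
    matrix of the family that satisfies it. *)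
Lemma mean_ge_term (I : eqType) (s : seq I) (F : I -> R) (c : R) :
  s != [::] -> (size s)%:R^-1 * \sum_(i <- s) F i <= c ->
  exists2 i, i \in s & F i <= c.
Proof.
move=> s0; have sz0 : 0 < (size s)%:R :> R by rewrite ltr0n lt0n size_eq0.
rewrite mulrC ler_pdivrMr// => Fc; apply/hasP; apply: contraLR Fc.
rewrite -all_predC -ltNge => /allP Fc.
have -> : c * (size s)%:R = \sum_(i <- s) c.
  by rewrite big_const_seq count_predT iter_addr_0 mulr_natr.
rewrite big_seq [ltRHS]big_seq.
apply: ltr_sum => [|i /Fc]; last by rewrite /= ltNge.
by case: s s0 {Fc sz0} => // i s _; rewrite /= mem_head.
Qed.

Lemma posdef_mean (I : eqType) (s : seq I) n (M : I -> 'M[R]_n) :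
  s != [::] -> {in s, forall i, posdef (M i)} ->
  posdef ((size s)%:R^-1 *: \sum_(i <- s) M i).
Proof.
move=> s0 Mpd; have sz0 : 0 < (size s)%:R :> R by rewrite ltr0n lt0n size_eq0.
split.
  rewrite linearZ /= linear_sum /=; congr (_ *: _).
  by apply: eq_big_seq => i /Mpd[].
move=> u u0; rewrite -scalemxAr -scalemxAl mxE mulr_gt0 ?invr_gt0//.
rewrite mulmx_sumr mulmx_suml summxE.
case: s s0 Mpd {sz0} => // i s _ Mpd; rewrite big_cons big_seq ltr_pwDl//.
  by have [_] := Mpd _ (mem_head i s); apply.
apply: sumr_ge0 => j js; have [|_ Mj] := Mpd j; first by rewrite inE js orbT.
exact/ltW/Mj.
Qed.

(** With [N] the mean, the traces of [invmx N *m M i] average to the trace of the identity, which is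
    [n]. An index whose trace is at most [n] satisfies the hypothesis of [posdef_det_le]. *)
Lemma posdef_det_mean (I : eqType) (s : seq I) n (M : I -> 'M[R]_n) :
  (0 < n)%N -> s != [::] -> {in s, forall i, posdef (M i)} ->
  exists2 i, i \in s &
    \det (M i) <= \det ((size s)%:R^-1 *: \sum_(i <- s) M i).
Proof.
move=> n0 s0 Mpd; set N := _ *: _.
have Npd : posdef N by exact: posdef_mean.
have [||i si trNM] := @mean_ge_term _ s
  (fun i => \tr (invmx N *m M i)) n%:R => //.
  (* The numerical product is read as a scaling of [R] over itself, so that linearity of the trace
     carries it inside. *)
  rewrite -linear_sum -mulmx_sumr -[_ * _]/(_ *: _) -linearZ /= scalemxAr -/N.
  by rewrite mulVmx ?posdef_unitmx// mxtrace1.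
by exists i => //; apply: posdef_det_le trNM => //; exact: Mpd.
Qed.

Definition possemidef n (A : 'M[R]_n) : Prop :=
  forall u : 'cV[R]_n, 0 <= (u^T *m A *m u) 0 0.

(** Diagonalizing [M] gives [A *m M *m A^T = C *m diag_mx e *m C^T]; the trace is then the sum of
    the values of the quadratic form [V] at the columns of [C], with positive coefficients [e]. *)
Lemma mxtrace_mul_ge0 n (V A M : 'M[R]_n) : possemidef V -> posdef M ->
  0 <= \tr (V *m (A *m M *m A^T)).
Proof.
move=> Vpsd /posdef_diag[P [e [detP PMP e0]]].
have Pu : P \in unitmx by rewrite unitmxE detP unitr1.
have PTu : P^T \in unitmx by rewrite unitmx_tr.
pose C := A *m invmx P.
have -> : A *m M *m A^T = C *m diag_mx e *m C^T.
  rewrite -PMP /C trmx_mul trmx_inv !mulmxA mulmxKV//.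
  by rewrite -[_ *m P^T *m _]mulmxA mulmxV// mulmx1.
rewrite {PMP}; clearbody C.
rewrite mulmxA mxtrace_mulC !mulmxA mul_mx_diag.
rewrite /mxtrace sumr_ge0// => i _; rewrite mxE mulr_ge0 ?(ltW (e0 i))//.
suff -> : (C^T *m V *m C) i i = ((col i C)^T *m V *m col i C) 0 0.
  exact: Vpsd.
by rewrite tr_col -row_mul !mxE; apply: eq_bigr => j _; rewrite !mxE.
Qed.

(** The previous lemma with [A := invmx M]. *)
Lemma posdef_inv_trace_ge0 n (V M : 'M[R]_n) : possemidef V -> posdef M ->
  0 <= \tr (V *m invmx M).
Proof.
move=> Vpsd Mpd; have := mxtrace_mul_ge0 (invmx M) Vpsd Mpd.
by rewrite mulVmx ?posdef_unitmx// mul1mx trmx_inv; case: Mpd => ->.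
Qed.

(* Expand [(M^-1 - N^-1) M (M^-1 - N^-1) = M^-1 - 2 N^-1 + N^-1 M N^-1]. *)
Lemma trace_inv_tangent n (V M N : 'M[R]_n) :
  possemidef V -> posdef M -> posdef N ->
  \tr (V *m invmx N) *+ 2 - \tr (V *m (invmx N *m M *m invmx N))
    <= \tr (V *m invmx M).
Proof.
move=> Vpsd Mpd Npd.
have Mu := posdef_unitmx Mpd.
have := mxtrace_mul_ge0 (invmx M - invmx N) Vpsd Mpd.
have [Mt _] := Mpd; have [Nt _] := Npd.
rewrite linearB /= !trmx_inv Mt Nt !(mulmxBl, mulmxBr) mulVmx// !mul1mx.
rewrite mulmxK// !linearB /= mulr2n.
lra.
Qed.

(** The linear terms of the tangent bounds at the mean [N] average to the trace of [V *m invmx N].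
    For an index whose linear term is at most this average, the tangent bound is at least that same
    trace. *)
Lemma posdef_trace_inv_mean (I : eqType) (s : seq I) n (V : 'M[R]_n)
    (M : I -> 'M[R]_n) :
  possemidef V -> s != [::] -> {in s, forall i, posdef (M i)} ->
  exists2 i, i \in s &
    \tr (V *m invmx ((size s)%:R^-1 *: \sum_(i <- s) M i))
      <= \tr (V *m invmx (M i)).
Proof.
move=> Vpsd s0 Mpd; set N := _ *: _.
have Npd : posdef N by exact: posdef_mean.
have sz0 : (size s)%:R != 0 :> R by rewrite pnatr_eq0 size_eq0.
have [||i si le_i] := @mean_ge_term _ s
  (fun i => \tr (V *m (invmx N *m M i *m invmx N))) (\tr (V *m invmx N)) => //.
  rewrite -linear_sum -mulmx_sumr -mulmx_suml -mulmx_sumr.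
  rewrite -[_ * _]/(_ *: _) -linearZ /= scalemxAr scalemxAl scalemxAr -/N.
  by rewrite mulVmx ?posdef_unitmx// mul1mx.
exists i => //; apply: le_trans (trace_inv_tangent Vpsd (Mpd _ si) Npd).
by rewrite mulr2n -addrA lerDl subr_ge0.
Qed.

End PositiveDefinite.

(** * Images of designs under bijections, and averages over a finite group *)

Section DesignImage.
Context {R : realType} {T : choiceType}.
Implicit Types (xi : {fsfun T -> R with 0}) (g h : T -> T).

(** The fibre of [g] over [y] is the single point [h y]; when [h y] is outside the support, both
    sides are the default 0. *)
Lemma design_imageE g h xi y :
  cancel g h -> cancel h g -> design_image g xi y = xi (h y).
Proof.
move=> gK hK; rewrite fsfunE; case: ifPn => [_|yN].
  under eq_bigl do rewrite (can2_eq gK hK).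
  have [hy|hy] := boolP (h y \in finsupp xi).
    by rewrite -big_filter filter_pred1_uniq ?fset_uniq// big_seq1.
  rewrite big_seq_cond big_pred0 ?fsfun_dflt// => x; apply: contraNF hy.
  by case/andP => + /eqP <-.
rewrite fsfun_dflt//; apply: contra yN => hy.
by apply/imfsetP; exists (h y); rewrite ?hK.
Qed.

Lemma finsupp_design_image g h xi : cancel g h -> cancel h g ->
  finsupp (design_image g xi) = [fset g x | x in finsupp xi]%fset.
Proof.
move=> gK hK; apply/fsetP => y; rewrite mem_finsupp (design_imageE _ _ gK hK).
rewrite -mem_finsupp; apply/idP/imfsetP => [hy|[x xxi ->]]; last by rewrite gK.
by exists (h y); rewrite ?hK.
Qed.

Lemma sum_design_image (V : nmodType) g h xi (F : T -> V) :
  cancel g h -> cancel h g ->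
  \sum_(y <- finsupp (design_image g xi)) F y = \sum_(x <- finsupp xi) F (g x).
Proof.
move=> gK hK; rewrite (finsupp_design_image _ gK hK) big_imfset//.
by move=> x y _ _; exact: (can_inj gK).
Qed.

Lemma design_imageK g h xi : cancel g h -> cancel h g ->
  design_image g (design_image h xi) = xi.
Proof.
move=> gK hK; apply/fsfunP => y.
by rewrite (design_imageE _ _ gK hK) (design_imageE _ _ hK gK) hK.
Qed.

Lemma is_design_image g h xi : cancel g h -> cancel h g ->
  is_design xi -> is_design (design_image g xi).
Proof.
move=> gK hK [xi_gt0 xi_sum]; split.
  move=> y; rewrite (finsupp_design_image _ gK hK) => /imfsetP[x /= xxi ->].
  by rewrite (design_imageE _ _ gK hK) gK xi_gt0.
rewrite (sum_design_image _ _ gK hK) -[RHS]xi_sum; apply: eq_bigr => x _.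
by rewrite (design_imageE _ _ gK hK) gK.
Qed.

(** A common finite domain for all the images. For arbitrary real weights cancellation may make the
    support of the average smaller, so only inclusions in this set are used. *)
Definition orbit_support (s : seq (T -> T)) xi : {fset T} :=
  [fset (g : T -> T) x | g in s, x in finsupp xi]%fset.

Definition orbit_average (s : seq (T -> T)) xi : {fsfun T -> R with 0} :=
  [fsfun y in orbit_support s xi =>
     (size s)%:R^-1 * \sum_(g <- s) design_image g xi y].

Variable s : seq (T -> T).
Hypothesis s_inv : {in s, forall g,
  exists2 h, h \in s & cancel g h /\ cancel h g}.

Lemma finsupp_design_image_sub g xi : g \in s ->
  (finsupp (design_image g xi) `<=` orbit_support s xi)%fset.
Proof.
move=> gs; have [h hs [gK hK]] := s_inv gs.
apply/fsubsetP => y; rewrite (finsupp_design_image _ gK hK).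
by case/imfsetP => x /= xxi ->; apply/imfset2P; exists g => //; exists x.
Qed.

Lemma orbit_averageE xi y :
  orbit_average s xi y = (size s)%:R^-1 * \sum_(g <- s) design_image g xi y.
Proof.
rewrite fsfunE; case: ifPn => // yN; rewrite big_seq big1 ?mulr0// => g gs.
rewrite fsfun_dflt//; apply: contra yN.
by move: y; apply/fsubsetP/finsupp_design_image_sub.
Qed.

Lemma finsupp_orbit_average_sub xi :
  (finsupp (orbit_average s xi) `<=` orbit_support s xi)%fset.
Proof. exact: finsupp_sub. Qed.

(** Every sum is extended to the common domain [orbit_support s xi], the added terms having weight
    0, and the summations are exchanged. A constant [F] gives the total weight; a matrix-valued [F]
    gives the information matrix. *)
Lemma sum_orbit_average (V : lmodType R) xi (F : T -> V) :
  \sum_(y <- finsupp (orbit_average s xi)) orbit_average s xi y *: F y =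
  (size s)%:R^-1 *: \sum_(g <- s)
    \sum_(y <- finsupp (design_image g xi)) design_image g xi y *: F y.
Proof.
rewrite (big_fset_incl _ (finsupp_orbit_average_sub xi)); last first.
  by move=> y _ /fsfun_dflt ->; rewrite scale0r.
under eq_bigr do rewrite orbit_averageE -scalerA scaler_suml.
rewrite -scaler_sumr exchange_big /=; congr (_ *: _).
apply: eq_big_seq => g gs.
rewrite (big_fset_incl _ (finsupp_design_image_sub xi gs))//.
by move=> y _ /fsfun_dflt ->; rewrite scale0r.
Qed.

Lemma is_design_orbit_average xi : s != [::] ->
  is_design xi -> is_design (orbit_average s xi).
Proof.
move=> s0 xid; have sz0 : (size s)%:R != 0 :> R by rewrite pnatr_eq0 size_eq0.
have gd g : g \in s -> is_design (design_image g xi).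
  by move=> /s_inv[h _ [gK hK]]; exact: is_design_image gK hK xid.
split=> [y yxi|].
  (* On the support the weight is nonzero, so nonnegativity suffices. *)
  rewrite lt_neqAle eq_sym -mem_finsupp yxi/= orbit_averageE.
  rewrite mulr_ge0 ?invr_ge0// big_seq sumr_ge0// => g /gd[g_gt0 _].
  by case: finsuppP => // /g_gt0/ltW.
have scaler1o (a : R) : a *: (1 : R^o) = a by exact: mulr1.
have := sum_orbit_average xi (fun=> 1 : R^o).
under eq_bigr do rewrite scaler1o.
move=> ->; rewrite (eq_big_seq (fun=> 1)) => [|g /gd[_ gsum]]; last first.
  by rewrite -[RHS]gsum; apply: eq_bigr => y _; rewrite scaler1o.
by rewrite big_const_seq count_predT iter_addr_0 /GRing.scale/= mulVf.
Qed.

(** Left translation by [h] permutes the group, so it only reorders the sum defining the average. *)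
Lemma design_image_orbit_average h xi : uniq s ->
  {in s &, forall g1 g2, g1 \o g2 \in s} -> h \in s ->
  design_image h (orbit_average s xi) = orbit_average s xi.
Proof.
move=> us s_comp hs; have [k ks [hK kK]] := s_inv hs.
apply/fsfunP => y; rewrite (design_imageE _ _ hK kK) !orbit_averageE.
congr (_ * _); symmetry.
have /(perm_big _) <- /= : perm_eq [seq h \o g | g <- s] s.
  apply: uniq_perm => //.
    rewrite map_inj_in_uniq// => g1 g2 _ _ eq12; apply/funext => x.
    by apply: (can_inj hK); rewrite -[LHS]/((h \o g1) x) eq12.
  move=> g; apply/mapP/idP => [[g' g's ->]|gs]; first exact: s_comp.
  exists (k \o g); first exact: s_comp.
  by apply/funext => x /=; rewrite kK.
rewrite big_map; apply: eq_big_seq => g gs.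
have [l _ [gK lK]] := s_inv gs.
rewrite [RHS](design_imageE _ _ gK lK) (@design_imageE (h \o g) (l \o k))//.
- by move=> x /=; rewrite hK gK.
- by move=> x /=; rewrite lK kK.
Qed.

End DesignImage.

(** The inverse of [k%:E * b] splits for every [b]: at [0], [+oo] and [-oo] the conventional inverse
    is zero or infinite and absorbs the positive factor. *)
Lemma divepM2l (R : realFieldType) (k : R) (a b : \bar R) : 0 < k ->
  (k%:E * a / (k%:E * b) = a / b)%E.
Proof.
move=> k0; suff -> : ((k%:E * b)^-1 = k^-1%:E * b^-1)%E.
  by rewrite muleACA -EFinM divff ?gt_eqF// mul1e.
have kV0 : 0 < k^-1 by rewrite invr_gt0.
case: b => [r| |]; last 2 first.
- by rewrite gt0_muley ?lte_fin// invey mule0.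
- by rewrite gt0_muleNy ?lte_fin// inveNy gt0_muleNy ?lte_fin.
- rewrite -EFinM !inver mulf_eq0 gt_eqF//=; case: eqP => [_|_].
    by rewrite gt0_muley ?lte_fin.
  by rewrite -EFinM invfM.
Qed.

(** * Symmetrization for an abstract equivariant criterion *)

Section Symmetrization.
Context {R : realType} {T : choiceType} {p : nat}.
Variables (Phi : 'cV[R]_p -> {fsfun T -> R with 0} -> \bar R).
Variables (s : seq (T -> T)) (B' : set 'cV[R]_p).
Variables (tg : (T -> T) -> 'cV[R]_p -> 'cV[R]_p).
Variable xiopt : 'cV[R]_p -> {fsfun T -> R with 0}.
Hypothesis s_inv : {in s, forall g,
  exists2 h, h \in s & cancel g h /\ cancel h g}.
Hypothesis tgB' : {in s, forall g, tg g @` B' = B'}.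
Hypothesis xioptP : forall beta, B' beta ->
  locally_optimal Phi beta (xiopt beta).
Hypothesis Phi_equivariant : {in s, forall g beta, B' beta ->
  exists2 k : R, 0 < k & forall xi, is_design xi ->
    Phi (tg g beta) (design_image g xi) = (k%:E * Phi beta xi)%E}.

(** The optimal value at [tg g beta] is [k] times that at [beta]: the image under [g] of one optimal
    design and the image under [h] of the other give the two inequalities. Only optimal values are
    compared; the optimal designs need not be images of each other. *)
Lemma efficiency_equivariant g beta xi : g \in s -> B' beta -> is_design xi ->
  (Phi (tg g beta) (design_image g xi) / Phi (tg g beta) (xiopt (tg g beta)) =
   Phi beta xi / Phi beta (xiopt beta))%E.
Proof.
move=> gs Bb xid; have [h hs [gK hK]] := s_inv gs.
have Btg : B' (tg g beta) by rewrite -(tgB' gs); exists beta.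
have [k k0 Phik] := Phi_equivariant gs Bb.
have [opt_d opt_le] := xioptP Bb; have [opt'_d opt'_le] := xioptP Btg.
suff -> : Phi (tg g beta) (xiopt (tg g beta)) =
    (k%:E * Phi beta (xiopt beta))%E.
  by rewrite Phik// divepM2l.
apply/eqP; rewrite eq_le; apply/andP; split.
  by rewrite -Phik//; apply/opt'_le/(is_design_image gK hK).
have hd : is_design (design_image h (xiopt (tg g beta))).
  exact: is_design_image hK gK _.
rewrite -[xiopt (tg g beta)](design_imageK _ gK hK) Phik//.
by rewrite lee_wpmul2l ?lee_fin ?(ltW k0)//; exact: opt_le.
Qed.

Hypotheses (s_neq0 : s != [::]) (s_uniq : uniq s).
Hypothesis s_comp : {in s &, forall g1 g2, g1 \o g2 \in s}.
Hypothesis Phi_ge0 : forall beta xi, B' beta -> is_design xi ->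
  (0 <= Phi beta xi)%E.
Hypothesis Phi_orbit_average : forall beta xi, B' beta -> is_design xi ->
  exists2 g, g \in s &
    (Phi beta (orbit_average s xi) <= Phi beta (design_image g xi))%E.

(** The [g] whose image does no better than the average may vary with [beta]. Pulling [beta] back
    along [tg g] to a point of [B'] turns the ratio of that image into a ratio of [xi], which the
    supremum for [xi] bounds. *)
Lemma maximin_criterion_orbit_average xi : is_design xi ->
  (maximin_criterion Phi xiopt B' (orbit_average s xi)
    <= maximin_criterion Phi xiopt B' xi)%E.
Proof.
move=> xid; apply: ge_ereal_sup => _ [beta Bb <-].
have [g gs le_g] := Phi_orbit_average Bb xid.
have [beta0 Bb0 tgb] : (tg g @` B') beta by rewrite (tgB' gs).
apply: (@le_trans _ _ (Phi beta (design_image g xi) / Phi beta (xiopt beta))%E).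
  rewrite lee_wpmul2r// inve_ge0 Phi_ge0//.
  by have [] := xioptP Bb.
rewrite -tgb efficiency_equivariant//.
by apply: ereal_sup_ubound; exists beta0.
Qed.

Lemma exists_invariant_maximin_efficient :
  (exists xi, maximin_efficient Phi xiopt B' xi) ->
  exists xi, maximin_efficient Phi xiopt B' xi /\ invariant_design [set` s] xi.
Proof.
move=> [xi [xid xi_le]]; exists (orbit_average s xi); split.
  split; first exact: is_design_orbit_average.
  move=> xi' xi'd; apply: le_trans (xi_le _ xi'd).
  exact: maximin_criterion_orbit_average.
by move=> g gs; exact: design_image_orbit_average.
Qed.

End Symmetrization.

(** * Information matrices and the D-criterion *)

Section InformationMatrix.
Context {R : realType} {T : choiceType} {p : nat}.
Variables (f : T -> 'cV[R]_p) (lam : R -> R).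

Lemma information_matrix_orbit_average (s : seq (T -> T)) beta xi :
  {in s, forall g, exists2 h, h \in s & cancel g h /\ cancel h g} ->
  information_matrix f lam (orbit_average s xi) beta =
  (size s)%:R^-1 *: \sum_(g <- s)
    information_matrix f lam (design_image g xi) beta.
Proof.
move=> s_inv; rewrite /information_matrix.
under eq_bigr do rewrite -scalerA.
rewrite sum_orbit_average//; congr (_ *: _); apply: eq_bigr => g _.
by apply: eq_bigr => y _; rewrite scalerA.
Qed.

(** The quadratic form at [u] is a sum of positively weighted squares of [(f x)^T *m u]. If it
    vanishes, so does each of these on the support, hence [M *m u = 0] and [u = 0]. *)
Lemma information_matrix_posdef beta xi :
  (forall x, 0 < lam (predictor f x beta)) -> is_design xi ->
  information_matrix f lam xi beta \in unitmx ->
  posdef (information_matrix f lam xi beta).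
Proof.
move=> lam0 [xi0 _]; set M := information_matrix _ _ _ _ => Mu; split.
  rewrite /M /information_matrix linear_sum /=; apply: eq_bigr => x _.
  by rewrite linearZ /= trmx_mul trmxK.
move=> u u0.
pose t x := (xi x * lam (predictor f x beta)) * ((f x)^T *m u) 0 0 ^+ 2.
have t0 x : x \in finsupp xi -> 0 <= t x.
  by move=> xxi; rewrite mulr_ge0 ?sqr_ge0// mulr_ge0 ?ltW ?xi0.
have uMu : (u^T *m M *m u) 0 0 = \sum_(x <- finsupp xi) t x.
  rewrite mulmx_sumr mulmx_suml summxE; apply: eq_bigr => x _.
  rewrite -scalemxAr -scalemxAl mxE /t; congr (_ * _).
  have -> : u^T *m (f x *m (f x)^T) *m u = ((f x)^T *m u)^T *m ((f x)^T *m u).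
    by rewrite trmx_mul trmxK !mulmxA.
  by rewrite [LHS]mxE big_ord1 mxE expr2.
rewrite uMu lt_neqAle eq_sym big_seq sumr_ge0 ?andbT// -big_seq.
apply: contraNneq u0 => /eqP; rewrite big_seq psumr_eq0// => /allP t_eq0.
rewrite -(mulKmx Mu u) (_ : M *m u = 0) ?mulmx0//.
rewrite mulmx_suml big_seq big1// => x xxi.
have := t_eq0 _ xxi; rewrite xxi /= mulf_eq0 sqrf_eq0 gt_eqF ?mulr_gt0 ?xi0//=.
move=> /eqP fu0; rewrite -scalemxAl -mulmxA.
by rewrite [_^T *m u]mx11_scalar fu0 raddf0 mulmx0 scaler0.
Qed.

Lemma information_matrix_image g h Q c beta beta' xi :
  cancel g h -> cancel h g -> (forall x, f (g x) = Q *m f x) ->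
  (forall x, lam (predictor f (g x) beta') = c * lam (predictor f x beta)) ->
  information_matrix f lam (design_image g xi) beta' =
  c *: (Q *m information_matrix f lam xi beta *m Q^T).
Proof.
move=> gK hK fg lamg; rewrite /information_matrix (sum_design_image _ _ gK hK).
rewrite mulmx_sumr mulmx_suml scaler_sumr; apply: eq_bigr => x _.
rewrite (design_imageE _ _ gK hK) gK lamg fg -scalemxAr -scalemxAl scalerA.
by rewrite trmx_mul !mulmxA; congr (_ *: _); ring.
Qed.

Lemma information_matrix_image_unit (Q M : 'M[R]_p) c : 0 < c -> Q \in unitmx ->
  (c *: (Q *m M *m Q^T) \in unitmx) = (M \in unitmx).
Proof.
move=> c0 Qu; rewrite unitmxZ ?unitfE ?gt_eqF// !unitmx_mul unitmx_tr Qu.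
by rewrite andbT.
Qed.

Variables (beta : 'cV[R]_p).
Hypothesis lam_gt0 : forall x, 0 < lam (predictor f x beta).

Lemma D_criterion_ge0 xi : (0 <= D_criterion f lam beta xi)%E.
Proof.
by rewrite /D_criterion; case: ifP; rewrite ?lee_fin ?powR_ge0 ?leey.
Qed.

(** If some image has a singular information matrix, its criterion is [+oo] and it serves as the
    bound. Otherwise [posdef_det_mean] applies, and the power [- p%:R^-1] reverses the order of
    determinants. *)
Lemma D_criterion_orbit_average (s : seq (T -> T)) xi : (0 < p)%N ->
  {in s, forall g, exists2 h, h \in s & cancel g h /\ cancel h g} ->
  s != [::] -> is_design xi ->
  exists2 g, g \in s & (D_criterion f lam beta (orbit_average s xi)
                        <= D_criterion f lam beta (design_image g xi))%E.
Proof.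
move=> p0 s_inv s0 xid; rewrite /D_criterion information_matrix_orbit_average//.
set M := fun g => information_matrix f lam (design_image g xi) beta.
have [Mu|] := boolP (all (fun g => M g \in unitmx) s); last first.
  by move=> /allPn[g gs /negbTE Mg]; exists g => //; rewrite -/(M g) Mg leey.
have Mpd : {in s, forall g, posdef (M g)}.
  move=> g gs; have [h hs [gK hK]] := s_inv _ gs.
  apply: information_matrix_posdef => //; first exact: is_design_image gK hK _.
  exact: (allP Mu).
have [g gs detg] := posdef_det_mean p0 s0 Mpd; exists g => //.
rewrite !ifT ?(allP Mu)//; last exact/posdef_unitmx/posdef_mean.
have Mg0 := posdef_det_gt0 (Mpd _ gs).
rewrite lee_fin !powRN lef_pV2 ?posrE ?powR_gt0 ?(lt_le_trans Mg0)//.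
by rewrite ge0_ler_powR ?invr_ge0 ?nnegrE ?(ltW Mg0)// ltW// (lt_le_trans Mg0).
Qed.

Lemma D_criterion_image g h Q c beta' : cancel g h -> cancel h g ->
  Q \in unitmx -> 0 < c -> (forall x, f (g x) = Q *m f x) ->
  (forall x, lam (predictor f (g x) beta') = c * lam (predictor f x beta)) ->
  exists2 k : R, 0 < k & forall xi, is_design xi ->
    D_criterion f lam beta' (design_image g xi) =
    (k%:E * D_criterion f lam beta xi)%E.
Proof.
move=> gK hK Qu c0 fg lamg.
have detQ0 : \det Q != 0 by rewrite -unitfE -unitmxE.
have k0 : 0 < c ^+ p * (\det Q) ^+ 2.
  by apply: mulr_gt0; [exact: exprn_gt0 | rewrite exprn_even_gt0].
(* From [\det (c *: (Q *m M *m Q^T)) = c ^+ p * (\det Q) ^+ 2 * \det M]. *)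
exists ((c ^+ p * (\det Q) ^+ 2) `^ (- p%:R^-1)); first exact: powR_gt0.
move=> xi xid; rewrite /D_criterion (information_matrix_image _ gK hK fg lamg).
rewrite information_matrix_image_unit//; case: ifPn => Mu; last first.
  by rewrite gt0_muley// lte_fin powR_gt0.
have /posdef_det_gt0 M0 := information_matrix_posdef lam_gt0 xid Mu.
rewrite -EFinM -powRM ?(ltW k0) ?(ltW M0)//; congr (_ `^ _)%:E.
rewrite detZ !det_mulmx det_tr; ring.
Qed.

End InformationMatrix.

(** * Integrals of finite linear combinations *)

Section RintegralLinear.
Context {R : realType} {d : measure_display} {T : measurableType d}.
Variables (mu : {measure set T -> \bar R}) (D : set T).
Hypothesis mD : measurable D.

Lemma integrable_lincomb (I : Type) (s : seq I) (a : I -> R) (F : I -> T -> R) :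
  (forall i, mu.-integrable D (EFin \o F i)) ->
  mu.-integrable D (EFin \o (fun x => \sum_(i <- s) a i * F i x)).
Proof.
move=> Fint.
have -> : EFin \o (fun x => \sum_(i <- s) a i * F i x) =
    fun x => (\sum_(i <- s) (a i)%:E * (EFin \o F i) x)%E.
  by apply/funext => x; rewrite /= -sumEFin.
by apply: integrable_sum => // i _; exact: integrableZl.
Qed.

Lemma Rintegral_lincomb (I : Type) (s : seq I) (a : I -> R) (F : I -> T -> R) :
  (forall i, mu.-integrable D (EFin \o F i)) ->
  Rintegral mu D (fun x => \sum_(i <- s) a i * F i x) =
  \sum_(i <- s) a i * Rintegral mu D (F i).
Proof.
move=> Fint; elim: s => [|i s IHs].
  rewrite big_nil -[RHS](mul0r (fine (mu D))) -Rintegral_cst//.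
  by apply: eq_Rintegral => x _; rewrite big_nil.
rewrite big_cons -IHs -RintegralZl// -RintegralD//.
- by apply: eq_Rintegral => x _; rewrite big_cons.
- exact: (@integrableZl _ _ _ _ _ mD (a i) (EFin \o F i)).
- exact: integrable_lincomb.
Qed.

End RintegralLinear.

(** * The IMSE weight matrix and the IMSE-criterion *)

Section IMSEWeight.
Context {R : realType} {d : measure_display} {T : measurableType d} {p : nat}.
Variables (f : T -> 'cV[R]_p) (lam : R -> R) (nu : probability T R).

(** The single sum over pairs of indices has the shape to which linearity of the integral is
    applied. *)
Lemma bilinear_coef (A : 'M[R]_p) (u v : 'cV[R]_p) :
  (u^T *m A *m v) 0 0 = \sum_(k : 'I_p * 'I_p) u k.1 0 * v k.2 0 * A k.1 k.2.
Proof.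
rewrite -(pair_bigA _ (fun i j => u i 0 * v j 0 * A i j)) /=.
rewrite exchange_big /= mxE.
apply: eq_bigr => j _; rewrite mxE mulr_suml; apply: eq_bigr => i _.
by rewrite mxE mulrAC.
Qed.

Lemma bilinear_IMSE_integrand beta (u v : 'cV[R]_p) x :
  lam (predictor f x beta) ^+ 2 * (u^T *m (f x *m (f x)^T) *m v) 0 0 =
  \sum_(k : 'I_p * 'I_p)
    u k.1 0 * v k.2 0 * IMSE_integrand f lam beta k.1 k.2 x.
Proof.
by rewrite bilinear_coef mulr_sumr; apply: eq_bigr => k _; rewrite mulrCA.
Qed.

Lemma integrable_bilinear beta (u v : 'cV[R]_p) :
  IMSE_weight_exists f lam nu beta ->
  nu.-integrable [set: T] (EFin \o (fun x =>
    lam (predictor f x beta) ^+ 2 * (u^T *m (f x *m (f x)^T) *m v) 0 0)).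
Proof.
move=> Vex; under [X in EFin \o X]eq_fun do rewrite bilinear_IMSE_integrand.
exact: integrable_lincomb.
Qed.

Lemma IMSE_weight_bilinear beta (u v : 'cV[R]_p) :
  IMSE_weight_exists f lam nu beta ->
  (u^T *m IMSE_weight f lam nu beta *m v) 0 0 =
  Rintegral nu [set: T] (fun x =>
    lam (predictor f x beta) ^+ 2 * (u^T *m (f x *m (f x)^T) *m v) 0 0).
Proof.
move=> Vex; under [RHS]eq_Rintegral do rewrite bilinear_IMSE_integrand.
rewrite Rintegral_lincomb// bilinear_coef.
by apply: eq_bigr => k _; rewrite mxE.
Qed.

Lemma IMSE_weight_possemidef beta :
  IMSE_weight_exists f lam nu beta -> possemidef (IMSE_weight f lam nu beta).
Proof.
move=> Vex u; rewrite IMSE_weight_bilinear//; apply: Rintegral_ge0 => x _.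
rewrite mulr_ge0 ?sqr_ge0//.
have -> : u^T *m (f x *m (f x)^T) *m u = ((f x)^T *m u)^T *m ((f x)^T *m u).
  by rewrite trmx_mul trmxK !mulmxA.
by rewrite mxE big_ord1 mxE -expr2 sqr_ge0.
Qed.

(** Entry [i j] of a congruence by [Q] is the bilinear form at rows [i] and [j] of [Q]. Hence the
    integrand at [beta'] composed with [g] is [c ^+ 2] times a bilinear integrand at [beta], the
    square coming from the squared intensity in the weight. *)
Lemma IMSE_weight_image g (Q : 'M[R]_p) c beta beta' :
  measurable_fun [set: T] g ->
  (forall A, measurable A -> pushforward nu g A = nu A) ->
  (forall x, f (g x) = Q *m f x) ->
  (forall x, lam (predictor f (g x) beta') = c * lam (predictor f x beta)) ->
  IMSE_weight_exists f lam nu beta -> IMSE_weight_exists f lam nu beta' ->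
  IMSE_weight f lam nu beta' =
    c ^+ 2 *: (Q *m IMSE_weight f lam nu beta *m Q^T).
Proof.
move=> mg nu_g fg lamg Vex Vex'; apply/matrixP => i j.
pose u := (row i Q)^T; pose v := (row j Q)^T.
have QQ (A : 'M[R]_p) : (Q *m A *m Q^T) i j = (u^T *m A *m v) 0 0.
  rewrite /u /v trmxK tr_row -row_mul !mxE.
  by apply: eq_bigr => k _; rewrite !mxE.
have comp_g : IMSE_integrand f lam beta' i j \o g = fun x => c ^+ 2 *
    (lam (predictor f x beta) ^+ 2 * (u^T *m (f x *m (f x)^T) *m v) 0 0).
  apply/funext => x; rewrite /= /IMSE_integrand lamg fg -QQ exprMn -mulrA.
  by rewrite trmx_mul !mulmxA.
have int_bil := integrable_bilinear u v Vex.
rewrite mxE [RHS]mxE QQ IMSE_weight_bilinear// -RintegralZl// -comp_g.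
have /integrableP[mF _] := Vex' i j.
have int_g : nu.-integrable (g @^-1` [set: T])
    ((EFin \o IMSE_integrand f lam beta' i j) \o g).
  rewrite preimage_setT -compA comp_g.
  exact: (@integrableZl _ _ _ _ _ measurableT (c ^+ 2) _ int_bil).
rewrite /Rintegral; congr fine.
(* Change of variables turns the integral of the composite into one against the image measure, which
   agrees with [nu] on measurable sets. *)
have := integral_pushforward mg mF int_g measurableT; rewrite preimage_setT.
move=> <-; apply: eq_measure_integral => A mA _; exact/esym/nu_g.
Qed.

Variables (beta : 'cV[R]_p).
Hypothesis lam_gt0 : forall x, 0 < lam (predictor f x beta).
Hypothesis weight_exists : IMSE_weight_exists f lam nu beta.

Lemma IMSE_criterion_ge0 xi : is_design xi ->
  (0 <= IMSE_criterion f lam nu beta xi)%E.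
Proof.
move=> xid; rewrite /IMSE_criterion; case: ifPn => [Mu|_]; last by rewrite leey.
rewrite lee_fin posdef_inv_trace_ge0//; first exact: IMSE_weight_possemidef.
exact: information_matrix_posdef.
Qed.

Lemma IMSE_criterion_orbit_average (s : seq (T -> T)) xi :
  {in s, forall g, exists2 h, h \in s & cancel g h /\ cancel h g} ->
  s != [::] -> is_design xi ->
  exists2 g, g \in s & (IMSE_criterion f lam nu beta (orbit_average s xi)
                        <= IMSE_criterion f lam nu beta (design_image g xi))%E.
Proof.
move=> s_inv s0 xid; rewrite /IMSE_criterion information_matrix_orbit_average//.
set M := fun g => information_matrix f lam (design_image g xi) beta.
have [Mu|] := boolP (all (fun g => M g \in unitmx) s); last first.
  by move=> /allPn[g gs /negbTE Mg]; exists g => //; rewrite -/(M g) Mg leey.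
have Mpd : {in s, forall g, posdef (M g)}.
  move=> g gs; have [h hs [gK hK]] := s_inv _ gs.
  apply: information_matrix_posdef => //; first exact: is_design_image gK hK _.
  exact: (allP Mu).
have [g gs trg] :=
  posdef_trace_inv_mean (IMSE_weight_possemidef weight_exists) s0 Mpd.
exists g => //; rewrite !ifT ?(allP Mu)//; last exact/posdef_unitmx/posdef_mean.
Qed.

(** The factor is [c] itself: the weight matrix contributes [c ^+ 2], the inverse information matrix
    [c^-1], and the factors [Q] cancel by cyclicity of the trace. *)
Lemma IMSE_criterion_image g h Q c beta' : cancel g h -> cancel h g ->
  measurable_fun [set: T] g ->
  (forall A, measurable A -> pushforward nu g A = nu A) ->
  Q \in unitmx -> 0 < c -> (forall x, f (g x) = Q *m f x) ->
  (forall x, lam (predictor f (g x) beta') = c * lam (predictor f x beta)) ->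
  IMSE_weight_exists f lam nu beta' ->
  exists2 k : R, 0 < k & forall xi, is_design xi ->
    IMSE_criterion f lam nu beta' (design_image g xi) =
    (k%:E * IMSE_criterion f lam nu beta xi)%E.
Proof.
move=> gK hK mg nu_g Qu c0 fg lamg Vex'; exists c => // xi xid.
rewrite /IMSE_criterion (information_matrix_image _ gK hK fg lamg).
rewrite information_matrix_image_unit//; case: ifPn => Mu; last first.
  by rewrite gt0_muley// lte_fin.
rewrite (IMSE_weight_image mg nu_g fg lamg weight_exists Vex') -EFinM.
set V := IMSE_weight _ _ _ _; set M := information_matrix _ _ _ _ in Mu *.
have QTu : Q^T \in unitmx by rewrite unitmx_tr.
have -> : invmx (c *: (Q *m M *m Q^T)) =
    c^-1 *: (invmx Q^T *m invmx M *m invmx Q).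
  rewrite invmxZ ?unitmxZ ?unitfE ?gt_eqF ?unitmx_mul ?Qu ?Mu//; congr (_ *: _).
  have QMQu : Q *m M *m Q^T \in unitmx by rewrite !unitmx_mul Qu Mu.
  apply: (can_inj (mulKmx QMQu)); rewrite mulmxV// !mulmxA.
  by rewrite mulmxK// mulmxK// mulmxV.
rewrite -scalemxAl -scalemxAr scalerA expr2 mulfK ?gt_eqF// linearZ /=.
by rewrite !mulmxA mulmxK// -!mulmxA mxtrace_mulC !mulmxA mulmxKV.
Qed.

End IMSEWeight.

(** * Behaviour of the intensity under the parameter transformations, and the conclusion for both
    criteria *)

Lemma predictor_image (R : realType) (T : choiceType) (p : nat)
    (f : T -> 'cV[R]_p) (g : T -> T) (Q : 'M[R]_p) beta x :
  Q \in unitmx -> f (g x) = Q *m f x ->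
  predictor f (g x) (invmx Q^T *m beta) = predictor f x beta.
Proof.
by move=> Qu fg; rewrite /predictor fg trmx_mul -mulmxA mulKVmx// unitmx_tr.
Qed.

(** In the linear case the predictor is unchanged and the factor is 1. In the extended case the
    predictor is multiplied by [c g beta], so the intensity [kappa / z ^+ 2] is multiplied by its
    inverse square; both predictors are positive, where this formula for [lam] holds. *)
Lemma intensity_image (R : realType) (T : choiceType) (p : nat)
    (f : T -> 'cV[R]_p) (lam : R -> R) (G : set (T -> T)) Q (B : set 'cV[R]_p)
    tg g beta :
  (forall g, G g -> Q g \in unitmx /\ forall x, f (g x) = Q g *m f x) ->
  parameter_transformations f lam G Q B tg -> G g -> B beta ->
  exists2 c, 0 < c & forall x,
    lam (predictor f (g x) (tg g beta)) = c * lam (predictor f x beta).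
Proof.
move=> hQ [_ htg] Gg Bb; have [Qu fg] := hQ _ Gg.
case: htg => [tgE|[[[kappa k0 lamE] pred0] [[c tgE] _]]].
  by exists 1 => // x; rewrite mul1r tgE// predictor_image.
have [c0 tgbE] := tgE _ _ Gg Bb.
exists (c g beta ^- 2) => [|x]; first by rewrite invr_gt0 exprn_gt0.
have pE : predictor f (g x) (tg g beta) = c g beta * predictor f x beta.
  rewrite tgbE -(predictor_image beta Qu (fg x)) /predictor.
  by rewrite -scalemxAr mxE.
have p0 := pred0 x beta Bb.
rewrite pE !lamE ?mulr_gt0//; field.
by rewrite !gt_eqF.
Qed.

Theorem corollary8 (R : realType) (d : measure_display) (T : measurableType d)
    (p : nat) (hp : (0 < p)%N)
    (f : T -> 'cV[R]_p) (hf : linearly_independent f)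
    (B : set 'cV[R]_p)
    (lam : R -> R) (hlam : forall x beta, B beta -> 0 < lam (predictor f x beta))
    (G : set (T -> T)) (hG : finite_transformation_group G)
    (Q : (T -> T) -> 'M[R]_p)
    (hQ : forall g, G g -> Q g \in unitmx /\ forall x, f (g x) = Q g *m f x)
    (tg : (T -> T) -> 'cV[R]_p -> 'cV[R]_p)
    (htg : parameter_transformations f lam G Q B tg)
    (B' : set 'cV[R]_p) (hB' : B' `<=` B)
    (hinv : forall g, G g -> tg g @` B' = B') :
  (forall (xiopt : 'cV[R]_p -> {fsfun T -> R with 0}),
     (forall beta, B' beta ->
        locally_optimal (D_criterion f lam) beta (xiopt beta)) ->
     (exists xi, maximin_efficient (D_criterion f lam) xiopt B' xi) ->
     exists xi, maximin_efficient (D_criterion f lam) xiopt B' xi /\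
                invariant_design G xi) /\
  (forall (nu : probability T R) (xiopt : 'cV[R]_p -> {fsfun T -> R with 0}),
     (forall beta, B' beta -> IMSE_weight_exists f lam nu beta) ->
     invariant_measure G nu ->
     (forall beta, B' beta ->
        locally_optimal (IMSE_criterion f lam nu) beta (xiopt beta)) ->
     (exists xi, maximin_efficient (IMSE_criterion f lam nu) xiopt B' xi) ->
     exists xi, maximin_efficient (IMSE_criterion f lam nu) xiopt B' xi /\
                invariant_design G xi).
Proof.
have [Gfin Gid Gcomp Ginv] := hG.
(* A duplicate-free enumeration of the group, over which averages can be formed and reindexed. *)
have [s s_uniq GE] : exists2 s : seq (T -> T), uniq s & G = [set` s].
  by have [S ->] := iffLR finite_fsetP Gfin; exists (S : seq _) => //;
    exact: fset_uniq.
have Gs g : G g <-> g \in s by rewrite GE.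
have s_inv : {in s, forall g, exists2 h, h \in s &
    cancel g h /\ cancel h g}.
  by move=> g /Gs/Ginv[h /Gs hs gh]; exists h.
have s_comp : {in s &, forall g1 g2, g1 \o g2 \in s}.
  by move=> g1 g2 /Gs G1 /Gs G2; apply/Gs/Gcomp.
have s0 : s != [::].
  by apply: contraTneq (iffLR (Gs id) Gid) => ->.
have s_tgB' : {in s, forall g, tg g @` B' = B'} by move=> g /Gs/hinv.
have lam0 beta : B' beta -> forall x, 0 < lam (predictor f x beta).
  by move=> /hB' Bb x; exact: hlam.
split=> [xiopt opt|nu xiopt Vex nu_inv opt] ex_xi; rewrite GE.
  apply: (@exists_invariant_maximin_efficient _ _ _ _ _ _ tg) => //.
  - move=> g /Gs Gg beta Bb; have [h _ [gK hK]] := Ginv _ Gg.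
    have [c c0 lamg] := intensity_image hQ htg Gg (hB' _ Bb).
    have [Qu fg] := hQ _ Gg.
    exact: (D_criterion_image (lam0 _ Bb) gK hK Qu c0 fg lamg).
  - by move=> beta xi _ _; exact: D_criterion_ge0.
  - by move=> beta xi /lam0 lamb; exact: D_criterion_orbit_average.
apply: (@exists_invariant_maximin_efficient _ _ _ _ _ _ tg) => //.
- move=> g /Gs Gg beta Bb; have [h _ [gK hK]] := Ginv _ Gg.
  have [c c0 lamg] := intensity_image hQ htg Gg (hB' _ Bb).
  have [Qu fg] := hQ _ Gg; have [mg nu_g] := nu_inv _ Gg.
  (* Stability of [B'] ensures that the weight matrix also exists at the transformed parameter. *)
  have Btg : B' (tg g beta) by rewrite -(hinv _ Gg); exists beta.
  exact: (IMSE_criterion_image (Vex _ Bb) gK hK mg nu_g Qu c0 fg lamg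
    (Vex _ Btg)).
- by move=> beta xi Bb; apply: IMSE_criterion_ge0; [exact: lam0 | exact: Vex].
- move=> beta xi Bb.
  by apply: IMSE_criterion_orbit_average; [exact: lam0 | exact: Vex | |].
Qed.
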